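(* Let $\mathcal{X}$ be a finite set, $\mathcal{H}$ a finite-dimensional Hilbert space, $W:\mathcal{X}\to\mathcal{S}(\mathcal{H})$ a classical-quantum channel, and let $p\in\mathcal{P}(\mathcal{X})$ satisfy $I(X;B)_{W\times p}=\inf_{q:\,W(q)=W(p)}I(X;B)_{W\times q}$. For each $n$ let $\mathcal{C}_n=(x^n(1),\dots,x^n(M_n))$ be a codebook of $M_n$ codewords in $\mathcal{X}^n$, and suppose $R_1:=\liminf_{n\to\infty}\frac1n\log M_n<I(X;B)_{W\times p}$. Then \[ \limsup_{n\to\infty}\tfrac12\big\|W^{\otimes n}_{\mathcal{C}_n}-W(p)^{\otimes n}\big\|_1=1 . \]
   Context: $\mathcal{S}(\mathcal{H})$ is the set of density matrices on $\mathcal{H}$, $\mathcal{P}(\mathcal{X})$ the set of probability distributions on $\mathcal{X}$. For $q\in\mathcal{P}(\mathcal{X})$, $W(q)=\sum_xq(x)W_x$ and $I(X;B)_{W\times q}=\sum_xq(x)D(W_x\|W(q))$ with $D(\rho\|\sigma)=\mathrm{Tr}\,\rho(\log\rho-\log\sigma)$; logarithms base 2; the infimum is over all $q\in\mathcal{P}(\mathcal{X})$ with $W(q)=W(p)$. For $x^n\in\mathcal{X}^n$, $W^{\otimes n}_{x^n}=W_{x_1}\otimes\cdots\otimes W_{x_n}$, and $W^{\otimes n}_{\mathcal{C}_n}:=\frac1{M_n}\sum_{m=1}^{M_n}W^{\otimes n}_{x^n(m)}$. *)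

(* Defs.v *)
From HB Require Import structures.
From mathcomp Require Import all_boot all_order all_algebra.
From mathcomp Require Import all_classical all_reals all_analysis.
From mathcomp Require Import complex mxtens.

Set Implicit Arguments.
Unset Strict Implicit.
Unset Printing Implicit Defensive.

Import Order.TTheory GRing.Theory Num.Theory.
Local Open Scope ring_scope.
Local Open Scope complex_scope.

Section QuantumDefs.
Variable R : realType.
Local Notation C := R[i].

(* logarithm base 2 (with the MathComp-Analysis convention ln x = 0 for x <= 0) *)
Definition log2 (x : R) : R := ln x / ln 2.

Definition adjmx m n (A : 'M[C]_(m, n)) : 'M[C]_(n, m) := (map_mx conjc A)^T.

Definition psdmx n (A : 'M[C]_n) : Prop :=
  A \is hermsymmx /\ forall v : 'rV[C]_n, 0 <= (v *m A *m adjmx v) 0 0.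

Definition density_mx n (A : 'M[C]_n) : Prop := psdmx A /\ \tr A = 1.

(* functional calculus of a real function on a normal matrix, via the
   library's spectral decomposition A = invmx U *m diag_mx X *m U *)
Definition mx_fun n (f : R -> R) (A : 'M[C]_n) : 'M[C]_n :=
  invmx (spectralmx A)
  *m diag_mx (map_mx (fun z : C => (f (complex.Re z))%:C) (spectral_diag A))
  *m spectralmx A.

Definition rel_entropy n (rho sigma : 'M[C]_n) : R :=
  complex.Re (\tr (rho *m (mx_fun log2 rho - mx_fun log2 sigma))).

Definition trace_norm n (A : 'M[C]_n) : R :=
  complex.Re (\tr (mx_fun (@Num.sqrt R) (adjmx A *m A))).

Definition is_distr (X : finType) (q : X -> R) : Prop :=
  (forall x, 0 <= q x) /\ \sum_(x : X) q x = 1.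

Definition chan_avg (X : finType) n (W : X -> 'M[C]_n) (q : X -> R) : 'M[C]_n :=
  \sum_(x : X) (q x)%:C *: W x.

Definition mutual_info (X : finType) n (W : X -> 'M[C]_n) (q : X -> R) : R :=
  \sum_(x : X) q x * rel_entropy (W x) (chan_avg W q).

Fixpoint tens_tuple d n : n.-tuple 'M[C]_d -> 'M[C]_(d ^ n) :=
  match n return n.-tuple 'M[C]_d -> 'M[C]_(d ^ n) with
  | 0 => fun _ => 1%:M
  | n'.+1 => fun t =>
      castmx (esym (expnS d n'), esym (expnS d n'))
        (thead t *t tens_tuple (behead_tuple t))
  end.

Definition chan_word (X : finType) d (W : X -> 'M[C]_d) n (xn : n.-tuple X)
  : 'M[C]_(d ^ n) := tens_tuple (map_tuple W xn).

Definition code_state (X : finType) d (W : X -> 'M[C]_d) n M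
  (cb : 'I_M -> n.-tuple X) : 'M[C]_(d ^ n) :=
  (M%:R)^-1 *: \sum_(m < M) chan_word W (cb m).

End QuantumDefs.

(* Main.v *)
Require Import Defs.
From HB Require Import structures.
From mathcomp Require Import all_boot all_order all_algebra.
From mathcomp Require Import all_classical all_reals all_analysis.
From mathcomp Require Import complex mxtens.
From mathcomp Require Import ring lra.

Set Implicit Arguments.
Unset Strict Implicit.
Unset Printing Implicit Defensive.

Import Order.TTheory GRing.Theory Num.Theory.
Local Open Scope ring_scope.

(* Put s = W(p), h(x) = Tr W_x ln W_x and hb = sum_x p(x) h(x). If W(q) = s then
   I(X;B)_{W x q} is, up to the factor ln 2, sum_x q(x) h(x) - Tr s ln s, so p
   solves a linear program. Its dual (obtained from Gordan's theorem, up to an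
   arbitrarily small e) is a Hermitian L such that
     hb - e + Tr L (W_x - s) <= h(x)   for all x.
   Let P be the spectral projection of L_1 + ... + L_n for values >= n (Tr s L - e),
   and for a codeword m let T_m project onto the large eigenvalues of its output
   state; rank T_m is about exp(- sum_i h(x_i(m))). Call m near if
   sum_i Tr W_{x_i(m)} L >= n (Tr s L - 2 e). By duality rank T_m is then at most
   exp(n (- hb + 4 e)). Let E be the orthogonal projection onto the span of the
   T_m P, m near. The test 1 - P + E accepts every codeword state: far ones through
   1 - P and near ones because it fixes T_m, all by Chebyshev's inequality. It
   accepts s^n with small probability only: 1 - P by Chebyshev, and E because its rank
   M_n exp(n (- hb + 4 e)) is much smaller than the inverse exp(- n Tr s ln s) of the
   typical eigenvalues of s^n. *)

(** * Gordan's theorem *)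

Section Gordan.
Context {R : realFieldType}.

Lemma seq_max_mem (x : R) (s : seq R) :
  exists2 m, m \in x :: s & forall y, y \in x :: s -> y <= m.
Proof.
elim: s x => [|a s IH] x.
  by exists x; rewrite ?mem_head// => y; rewrite mem_seq1 => /eqP ->.
have [m mas hm] := IH a; have [xm|mx] := leP x m.
  exists m; first by rewrite inE mas orbT.
  by move=> y; rewrite inE => /predU1P[->//|]; apply: hm.
exists x; first exact: mem_head.
by move=> y; rewrite inE => /predU1P[->//|/hm ym]; exact: le_trans ym (ltW mx).
Qed.

(** One-variable step of the elimination. Take the midpoint of the largest lower and the smallest
    upper bound; if only one list is nonempty, step by 1 past its extreme element. *)
Lemma seq_strict_between (ls us : seq R) :
    (forall l u, l \in ls -> u \in us -> l < u) ->
  exists t, (forall l, l \in ls -> l < t) /\ (forall u, u \in us -> t < u).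
Proof.
have minus (s : seq R) x : exists2 m, m \in x :: s & forall y, y \in x :: s -> m <= y.
  have [m hm Hm] := seq_max_mem (- x) (map -%R s).
  exists (- m).
    by move: hm; rewrite -map_cons => /mapP[z zs ->]; rewrite opprK.
  by move=> y ys; rewrite lerNl Hm// -map_cons map_f.
case: ls us => [|l ls] [|u us] H.
- by exists 0; split.
- have [m _ hm] := minus us u; exists (m - 1); split=> // v /hm; lra.
- have [m _ hm] := seq_max_mem l ls; exists (m + 1); split=> // v /hm; lra.
- have [a ain ha] := seq_max_mem l ls; have [b bin hb] := minus us u.
  have ab := H _ _ ain bin.
  exists ((a + b) / 2); split=> v; [move/ha|move/hb]; lra.
Qed.

(* Fourier-Motzkin elimination of the first coordinate: the pairs of
   indices on which it has opposite signs form the new index set. *)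
Lemma gordan (k : nat) (X : finType) (u : X -> 'I_k -> R) :
  (exists y : 'I_k -> R, forall x, 0 < \sum_j y j * u x j) \/
  (exists q : X -> R, [/\ forall x, 0 <= q x, 0 < \sum_x q x &
     forall j, \sum_x q x * u x j = 0]).
Proof.
elim: k X u => [|k IH] X u.
  (* Without coordinates the only obstruction is a nonempty [X], witnessed by constant weights 1. *)
  have [x0 _|X0] := pickP (@predT X).
    right; exists (fun=> 1); split=> [x||[]//]; first exact: ler01.
    by rewrite (bigD1 x0)//= ltr_wpDr// sumr_ge0.
  by left; exists (fun=> 0) => x; have := X0 x.
pose a x := u x ord0.
(* Besides the pairs of opposite signs, [P] keeps the diagonal pair of each index whose first
   coordinate is zero. On [P], [al] and [be] are nonnegative multipliers that cancel the first
   coordinate. *)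
pose P (z : X * X) := ((0 < a z.1) && (a z.2 < 0)) || ((z.1 == z.2) && (a z.1 == 0)).
pose al (z : X * X) := if a z.1 == 0 then 1 else - a z.2.
pose be (z : X * X) := if a z.1 == 0 then 0 else a z.1.
have alge0 z : P z -> 0 <= al z.
  by rewrite /P /al; case: (a z.1 =P 0) => [->|_] /=; rewrite ?ler01// andbF orbF => /andP[_]; lra.
have bege0 z : P z -> 0 <= be z.
  by rewrite /P /be; case: (a z.1 =P 0) => [->|_] //=; rewrite andbF orbF => /andP[]; lra.
have abgt0 z : P z -> 0 < al z + be z.
  rewrite /P /al /be; case: (a z.1 =P 0) => [->|_] /=; first by move=> _; lra.
  by rewrite andbF orbF => /andP[]; lra.
have ab0 z : P z -> al z * a z.1 + be z * a z.2 = 0.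
  by rewrite /al /be; case: (a z.1 =P 0) => [->|_] _; ring.
pose u' (z : {z : X * X | P z}) (j : 'I_k) :=
  al (val z) * u (val z).1 (lift ord0 j) + be (val z) * u (val z).2 (lift ord0 j).
have [[y hy]|[q [q0 q1 qu]]] := IH _ u'.
  left.
  pose Y x := \sum_j y j * u x (lift ord0 j).
  have YP z : P z -> 0 < al z * Y z.1 + be z * Y z.2.
    move=> Pz; have := hy (exist _ z Pz); rewrite /u' /=.
    rewrite /Y !mulr_sumr -big_split/=.
    by under eq_bigr do (rewrite mulrDr mulrCA (mulrCA (y _) (be z))).
  (* Positivity at [x] reads [0 < t * a x + Y x]: a lower bound on the new coordinate [t] if
     [a x > 0], an upper bound if [a x < 0]. By [YP] on mixed pairs these bounds are compatible. *)
  have [|t [tl tu]] := @seq_strict_between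
    [seq - Y x / a x | x <- enum X & 0 < a x] [seq Y x / - a x | x <- enum X & a x < 0].
    move=> l v /mapP[x]; rewrite mem_filter => /andP[ax _] -> /mapP[z].
    rewrite mem_filter => /andP[az _] ->.
    have := YP (x, z); rewrite /P/= ax az/= => /(_ isT).
    rewrite /al /be/= gt_eqF// => h.
    by rewrite ltr_pdivrMr// mulrAC ltr_pdivlMr ?oppr_gt0//; lra.
  exists (fun j => if unlift ord0 j is Some j' then y j' else t) => x.
  rewrite big_ord_recl unlift_none.
  under eq_bigr do rewrite liftK.
  rewrite -/(Y x) -/(a x).
  have [ax|ax|ax] := ltgtP (a x) 0.
  - have : t < Y x / - a x by apply: tu; apply/mapP; exists x => //; rewrite mem_filter ax mem_enum.
    by rewrite ltr_pdivlMr ?oppr_gt0//; lra.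
  - have : - Y x / a x < t by apply: tl; apply/mapP; exists x => //; rewrite mem_filter ax mem_enum.
    by rewrite ltr_pdivrMr//; lra.
  - have := YP (x, x); rewrite /P /al /be/= ax !eqxx/= ltxx => /(_ isT); lra.
right.
(* Each vector of the reduced system combines two original ones, so its weight is passed on to these
   two. *)
pose q' x := \sum_z
  q z * (al (val z) * ((val z).1 == x)%:R + be (val z) * ((val z).2 == x)%:R).
exists q'; have key (F : X -> R) : \sum_x q' x * F x =
    \sum_z q z * (al (val z) * F (val z).1 + be (val z) * F (val z).2).
  under eq_bigr do rewrite mulr_suml.
  rewrite exchange_big/=; apply: eq_bigr => z _.
  have del b : \sum_x (b == x)%:R * F x = F b.
    rewrite (bigD1 b)//= eqxx mul1r big1 ?addr0// => x /negPf xb.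
    by rewrite eq_sym xb mul0r.
  rewrite -(del (val z).1) -(del (val z).2) !mulr_sumr -big_split mulr_sumr/=.
  by apply: eq_bigr => x _; ring.
split.
- move=> x; apply: sumr_ge0 => z _; apply: mulr_ge0 => //.
  by rewrite addr_ge0// mulr_ge0// ?alge0 ?bege0// (valP z).
- have := key (fun=> 1); under eq_bigr do rewrite mulr1.
  move=> ->; rewrite lt_neqAle sumr_ge0 ?andbT; last first.
    by move=> z _; rewrite mulr_ge0// !mulr1 ltW// abgt0// (valP z).
  apply/eqP => /esym/eqP; rewrite psumr_eq0; last first.
    by move=> z _; rewrite mulr_ge0// !mulr1 ltW// abgt0// (valP z).
  move=> /allP h; move: q1; rewrite big1 ?ltxx// => z _.
  have := h z (mem_index_enum z); rewrite /= !mulr1 mulf_eq0 => /orP[/eqP//|/eqP e].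
  by have := abgt0 _ (valP z); rewrite e ltxx.
- move=> j; rewrite key; case: (unliftP ord0 j) => [j'|] ->; first exact: qu.
  by rewrite big1// => z _; rewrite ab0 ?mulr0// (valP z).
Qed.
End Gordan.

(** * Product distributions on ['I_(d ^ n)] *)

Section ProductWeights.
Variables (X : Type) (d : nat).

Definition split_index n (j : 'I_(d ^ n.+1)) : 'I_d * 'I_(d ^ n) :=
  mxtens_unindex (cast_ord (expnS d n) j).

Definition join_index n (k : 'I_d * 'I_(d ^ n)) : 'I_(d ^ n.+1) :=
  cast_ord (esym (expnS d n)) (mxtens_index k).

Lemma join_indexK n : cancel (@join_index n) (@split_index n).
Proof. by move=> k; rewrite /split_index cast_ordKV mxtens_indexK. Qed.

Lemma split_indexK n : cancel (@split_index n) (@join_index n).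
Proof. by move=> j; rewrite /join_index mxtens_unindexK cast_ordK. Qed.

Lemma sum_split_index (V : nmodType) n (F : 'I_(d ^ n.+1) -> V) :
  \sum_j F j = \sum_a \sum_b F (join_index (a, b)).
Proof.
rewrite pair_big/= (reindex (@join_index n))/=; last first.
  by exists (@split_index n) => j _; rewrite (join_indexK, split_indexK).
by apply: eq_bigr => -[].
Qed.

(** If each [f y] is a distribution, this is the joint law of independent indices, one per letter. A
    general [K] also covers products of complex diagonal entries. *)
Fixpoint word_prod (K : pzSemiRingType) (f : X -> 'I_d -> K) n :
    n.-tuple X -> 'I_(d ^ n) -> K :=
  match n return n.-tuple X -> 'I_(d ^ n) -> K with
  | 0 => fun _ _ => 1
  | n'.+1 => fun x j => f (thead x) (split_index j).1 *
                        word_prod f (behead_tuple x) (split_index j).2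
  end.

Fixpoint word_sum (K : pzSemiRingType) (f : X -> 'I_d -> K) n :
    n.-tuple X -> 'I_(d ^ n) -> K :=
  match n return n.-tuple X -> 'I_(d ^ n) -> K with
  | 0 => fun _ _ => 0
  | n'.+1 => fun x j => f (thead x) (split_index j).1 +
                        word_sum f (behead_tuple x) (split_index j).2
  end.

Lemma word_prodS (K : pzSemiRingType) (f : X -> 'I_d -> K) n (x : n.+1.-tuple X) j :
  word_prod f x j = f (thead x) (split_index j).1 *
                  word_prod f (behead_tuple x) (split_index j).2.
Proof. by []. Qed.

Lemma word_prod_join (K : pzSemiRingType) (f : X -> 'I_d -> K) n x
    (xs : n.-tuple X) a b :
  word_prod f [tuple of x :: xs] (join_index (a, b)) = f x a * word_prod f xs b.
Proof.
by rewrite word_prodS join_indexK theadE/=; congr (_ * word_prod _ _ _); apply: val_inj.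
Qed.

Lemma word_sumS (K : pzSemiRingType) (f : X -> 'I_d -> K) n (x : n.+1.-tuple X) j :
  word_sum f x j = f (thead x) (split_index j).1 +
                  word_sum f (behead_tuple x) (split_index j).2.
Proof. by []. Qed.

Lemma word_sum_join (K : pzSemiRingType) (f : X -> 'I_d -> K) n x
    (xs : n.-tuple X) a b :
  word_sum f [tuple of x :: xs] (join_index (a, b)) = f x a + word_sum f xs b.
Proof.
by rewrite word_sumS join_indexK theadE/=; congr (_ + word_sum _ _ _); apply: val_inj.
Qed.

Lemma sum_word_prod (K : comPzSemiRingType) (f : X -> 'I_d -> K) n
    (x : n.-tuple X) :
  (forall y, \sum_k f y k = 1) -> \sum_j word_prod f x j = 1.
Proof.
move=> f1; elim: n x => [|n IH] x; first by rewrite /= big_ord1.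
case/tupleP: x => y x; rewrite sum_split_index -(f1 y).
apply: eq_bigr => a _; rewrite -[RHS]mulr1 -(IH x) mulr_sumr.
by apply: eq_bigr => b _; rewrite word_prod_join.
Qed.

Lemma word_prod_ge0 (K : numDomainType) (f : X -> 'I_d -> K) n
    (x : n.-tuple X) j :
  (forall y k, 0 <= f y k) -> 0 <= word_prod f x j.
Proof. by move=> f0; elim: n x j => [|n IH] x j //=; rewrite mulr_ge0. Qed.

Variables (R : realFieldType) (w g : X -> 'I_d -> R).
Hypotheses (w0 : forall y k, 0 <= w y k) (w1 : forall y, \sum_k w y k = 1).
Let mean y := \sum_k w y k * g y k.
Let dev y k := g y k - mean y.

Lemma sum_dev y : \sum_k w y k * dev y k = 0.
Proof.
under eq_bigr do rewrite mulrBr.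
by rewrite sumrB -mulr_suml w1 mul1r subrr.
Qed.

Lemma word_sum_dev n (x : n.-tuple X) j :
  word_sum dev x j = word_sum g x j - \sum_(y <- x) mean y.
Proof.
elim: n x j => [|n IH] x j; first by rewrite tuple0/= big_nil subrr.
case/tupleP: x => y x; rewrite -[j]split_indexK; case: split_index => a b.
by rewrite !word_sum_join IH big_cons /dev; ring.
Qed.

Lemma word_sum_dev_mean n (x : n.-tuple X) :
  \sum_j word_prod w x j * word_sum dev x j = 0.
Proof.
elim: n x => [|n IH] x; first by rewrite /= big_ord1 mulr0.
case/tupleP: x => y x; rewrite sum_split_index.
transitivity (\sum_a (w y a * dev y a * (\sum_b word_prod w x b)
   + w y a * \sum_b word_prod w x b * word_sum dev x b)).
  apply: eq_bigr => a _; rewrite !mulr_sumr -big_split.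
  by apply: eq_bigr => b _; rewrite word_prod_join word_sum_join /=; ring.
rewrite IH sum_word_prod//.
by under eq_bigr do rewrite mulr1 mulr0 addr0; rewrite sum_dev.
Qed.

(** Variance is additive over independent terms: after splitting off the first letter, the cross
    term contains the mean deviation of the rest, which is zero. *)
Lemma word_sum_dev_var n (x : n.-tuple X) :
  \sum_j word_prod w x j * word_sum dev x j ^+ 2
  = \sum_(y <- x) \sum_k w y k * dev y k ^+ 2.
Proof.
elim: n x => [|n IH] x; first by rewrite /= big_ord1 tuple0 big_nil expr0n mulr0.
case/tupleP: x => y x; rewrite sum_split_index big_cons.
transitivity (\sum_a (w y a * dev y a ^+ 2 * (\sum_b word_prod w x b)
   + 2 * (w y a * dev y a) * (\sum_b word_prod w x b * word_sum dev x b)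
   + w y a * \sum_b word_prod w x b * word_sum dev x b ^+ 2)).
  apply: eq_bigr => a _; rewrite !mulr_sumr -!big_split.
  by apply: eq_bigr => b _; rewrite word_prod_join word_sum_join /=; ring.
rewrite IH sum_word_prod// word_sum_dev_mean big_split/= -mulr_suml w1 mul1r.
by under eq_bigr do rewrite mulr1 mulr0 addr0.
Qed.

(** Chebyshev's inequality: on [Q] the squared deviation is at least [(n e)^2], while the variance
    of the sum is at most [n V]. *)
Lemma word_sum_chebyshev n (x : n.-tuple X) (V e : R) (Q : pred 'I_(d ^ n)) :
    0 < e -> (0 < n)%N ->
    (forall y, \sum_k w y k * (g y k - \sum_l w y l * g y l) ^+ 2 <= V) ->
    (forall j, Q j ->
      n%:R * e <= `|word_sum g x j - \sum_(y <- x) \sum_k w y k * g y k|) ->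
  \sum_(j | Q j) word_prod w x j <= V / (n%:R * e ^+ 2).
Proof.
move=> e0 n0 hV hQ; have n0' : (0 : R) < n%:R by rewrite ltr0n.
have en : 0 < (n%:R * e) ^+ 2 by rewrite exprn_gt0// mulr_gt0.
have -> : V / (n%:R * e ^+ 2) = (n%:R * V) / (n%:R * e) ^+ 2.
  by field; rewrite !gt_eqF.
rewrite ler_pdivlMr// mulr_suml.
apply: (@le_trans _ _ (\sum_j word_prod w x j * word_sum dev x j ^+ 2)).
  rewrite [leRHS](bigID Q)/= ler_wpDr//.
    by apply: sumr_ge0 => j _; rewrite mulr_ge0 ?word_prod_ge0 ?sqr_ge0.
  apply: ler_sum => j Qj; apply: ler_wpM2l; first exact: word_prod_ge0.
  rewrite word_sum_dev -[leRHS]real_normK ?num_real//.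
  rewrite ler_pXn2r ?nnegrE ?normr_ge0 ?hQ//.
  by rewrite mulr_ge0// ltW.
rewrite word_sum_dev_var.
apply: (@le_trans _ _ (\sum_(y <- x) V)); first exact: ler_sum.
by rewrite big_const_seq count_predT size_tuple iter_addr_0 mulr_natl.
Qed.

End ProductWeights.

(** * Spectral calculus of Hermitian matrices *)

Section SpectralCalculus.
Variable R : realType.
Local Notation C := R[i].
Local Notation Re := (@complex.Re R).
Local Open Scope complex_scope.

Lemma Re_sum (I : Type) (s : seq I) (Q : pred I) (F : I -> C) :
  Re (\sum_(i <- s | Q i) F i) = \sum_(i <- s | Q i) Re (F i).
Proof. exact: raddf_sum. Qed.

Lemma Re_realM (x : R) (z : C) : Re (x%:C * z) = x * Re z.
Proof. by case: z => a b /=; rewrite mul0r subr0. Qed.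

(** * Adjoints *)

Lemma adjmxE m n (A : 'M[C]_(m, n)) i j : adjmx A i j = Num.conj (A j i).
Proof. by rewrite !mxE. Qed.

Lemma adjmxK m n : cancel (@adjmx R m n) (@adjmx R n m).
Proof. by move=> A; apply/matrixP => i j; rewrite !mxE conjcK. Qed.

Lemma adjmx_mul m n k (A : 'M[C]_(m, n)) (B : 'M[C]_(n, k)) :
  adjmx (A *m B) = adjmx B *m adjmx A.
Proof. by rewrite /adjmx map_mxM trmx_mul. Qed.

Lemma adjmxD m n (A B : 'M[C]_(m, n)) : adjmx (A + B) = adjmx A + adjmx B.
Proof. by apply/matrixP => i j; rewrite !mxE rmorphD. Qed.

Lemma adjmxB m n (A B : 'M[C]_(m, n)) : adjmx (A - B) = adjmx A - adjmx B.
Proof. by apply/matrixP => i j; rewrite !mxE rmorphB. Qed.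

Lemma adjmx1 n : adjmx 1%:M = 1%:M :> 'M[C]_n.
Proof. by rewrite /adjmx map_mx1 trmx1. Qed.

Lemma adjmxZ m n (a : R) (A : 'M[C]_(m, n)) : adjmx (a%:C *: A) = a%:C *: adjmx A.
Proof. by apply/matrixP => i j; rewrite !mxE rmorphM; congr (_ * _); exact: conjc_real. Qed.

Lemma adjmx_sum (I : Type) (s : seq I) (Q : pred I) m n (F : I -> 'M[C]_(m, n)) :
  adjmx (\sum_(i <- s | Q i) F i) = \sum_(i <- s | Q i) adjmx (F i).
Proof.
elim/big_rec2: _ => [|i A B _ <-]; last by rewrite adjmxD.
by apply/matrixP => i j; rewrite !mxE rmorph0.
Qed.

Lemma hermsymmx_adj n (A : 'M[C]_n) : (A \is hermsymmx) = (adjmx A == A).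
Proof. by rewrite is_hermitianmxE expr0 scale1r eq_sym /adjmx map_trmx. Qed.

(** * Real diagonal matrices in a unitary basis *)

Definition rdiag n (r : 'I_n -> R) : 'M[C]_n := diag_mx (\row_j (r j)%:C).

Lemma adjmx_rdiag n (r : 'I_n -> R) : adjmx (rdiag r) = rdiag r.
Proof.
apply/matrixP => i j; rewrite !mxE rmorphMn eq_sym.
case: eqP => [->|_]; last by rewrite !mulr0n.
by rewrite !mulr1n; exact: conjc_real.
Qed.

Lemma rdiagM n (r s : 'I_n -> R) : rdiag r *m rdiag s = rdiag (fun j => r j * s j).
Proof.
rewrite mulmx_diag; congr diag_mx; apply/matrixP => i j.
by rewrite !mxE rmorphM.
Qed.

Lemma mul_rdiag_diag n (r : 'I_n -> R) (A : 'M[C]_n) j :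
  (rdiag r *m A) j j = (r j)%:C * A j j.
Proof. by rewrite mul_diag_mx !mxE. Qed.

Definition unitary n (U : 'M[C]_n) := U *m adjmx U = 1%:M.

Lemma unitary_adj n (U : 'M[C]_n) : unitary U -> adjmx U *m U = 1%:M.
Proof. exact: mulmx1C. Qed.

(* The Hermitian matrix with eigenvalues [r] along the rows of [U]. *)
Definition spec n (U : 'M[C]_n) (r : 'I_n -> R) : 'M[C]_n :=
  adjmx U *m rdiag r *m U.

Lemma spec_adj n (U : 'M[C]_n) r : adjmx (spec U r) = spec U r.
Proof. by rewrite /spec !adjmx_mul adjmxK adjmx_rdiag mulmxA. Qed.

Lemma specM n (U : 'M[C]_n) r s : unitary U ->
  spec U r *m spec U s = spec U (fun j => r j * s j).
Proof.
by move=> hU; rewrite /spec -rdiagM -!mulmxA (mulmxA U (adjmx U)) hU mul1mx.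
Qed.

Lemma specD n (U : 'M[C]_n) r s : spec U r + spec U s = spec U (fun j => r j + s j).
Proof.
rewrite /spec -mulmxDl -mulmxDr; congr (_ *m _ *m _).
by apply/matrixP => i j; rewrite !mxE -mulrnDl rmorphD.
Qed.

Lemma spec1 n (U : 'M[C]_n) : unitary U -> spec U (fun=> 1) = 1%:M.
Proof.
move=> hU; rewrite /spec (_ : rdiag _ = 1%:M) ?mulmx1 ?unitary_adj//.
by apply/matrixP => i j; rewrite !mxE.
Qed.

Lemma eq_spec n (U : 'M[C]_n) r s : r =1 s -> spec U r = spec U s.
Proof. by move=> rs; congr spec; apply/funext. Qed.

Lemma spectralmx_unitary n (A : 'M[C]_n) : unitary (spectralmx A).
Proof.
by have /unitarymxP := spectral_unitarymx A; rewrite /unitary /adjmx map_trmx.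
Qed.

Lemma invmx_spectral n (A : 'M[C]_n) : invmx (spectralmx A) = adjmx (spectralmx A).
Proof. by rewrite invmx_unitary ?spectral_unitarymx// /adjmx map_trmx. Qed.

Definition eigv n (A : 'M[C]_n) (j : 'I_n) : R := Re (spectral_diag A 0 j).

Lemma hermitian_spec n (A : 'M[C]_n) : adjmx A = A -> A = spec (spectralmx A) (eigv A).
Proof.
move=> /eqP; rewrite -hermsymmx_adj => hA.
have /orthomx_spectralP := hermitian_normalmx hA.
rewrite invmx_spectral => {1}->; congr (_ *m diag_mx _ *m _).
apply/matrixP => i j; rewrite ord1 mxE RRe_real//.
by have /mxOverP := hermitian_spectral_diag_real hA.
Qed.

Lemma mx_funE n f (A : 'M[C]_n) :
  mx_fun f A = spec (spectralmx A) (f \o eigv A).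
Proof.
rewrite /mx_fun invmx_spectral; congr (_ *m diag_mx _ *m _).
by apply/matrixP => i j; rewrite ord1 !mxE.
Qed.

(* Two diagonalisations of the same matrix are intertwined by a matrix whose
   nonzero entries link equal eigenvalues only, hence also intertwine the
   images of the eigenvalues under [f]. *)
Lemma mx_fun_spec n f (U : 'M[C]_n) r : unitary U ->
  mx_fun f (spec U r) = spec U (f \o r).
Proof.
move=> hU; rewrite mx_funE; set A := spec U r.
set V := spectralmx A; have hV : unitary V := spectralmx_unitary A.
have hA : spec V (eigv A) = spec U r by rewrite -hermitian_spec// spec_adj.
pose X := V *m adjmx U.
have key g s t : (spec V s = spec U t -> rdiag s *m X = X *m rdiag t) /\
    (rdiag (g \o s) *m X = X *m rdiag (g \o t) -> spec V (g \o s) = spec U (g \o t)).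
  split=> [/(congr1 (fun B => V *m B *m adjmx U))|h].
    by rewrite /spec !mulmxA hV mul1mx -!mulmxA hU mulmx1 !mulmxA.
  move: h => /(congr1 (fun B => adjmx V *m B *m U)).
  rewrite /X /spec !mulmxA (unitary_adj hV) mul1mx => <-.
  by rewrite -!mulmxA (unitary_adj hU) mulmx1.
clearbody X; apply: (key f _ _).2; have /(key f _ _).1 := hA.
move=> /matrixP h; apply/matrixP => i j; have := h i j.
rewrite !mul_diag_mx !mul_mx_diag !mxE => e.
have [->|nz] := eqVneq (X i j) 0; first by rewrite mulr0 mul0r.
move: e; rewrite mulrC => /(mulfI nz) /complexI e.
by rewrite /= e mulrC.
Qed.

(** For a density matrix [A] and a unitary [U], the outcome probabilities of measuring [A] in the
    orthonormal basis given by [U]. *)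
Definition diag_in n (U A : 'M[C]_n) (j : 'I_n) : R := Re ((U *m A *m adjmx U) j j).

Lemma Re_tr_spec n (U A : 'M[C]_n) r :
  Re (\tr (A *m spec U r)) = \sum_j r j * diag_in U A j.
Proof.
rewrite /spec !mulmxA mxtrace_mulC !mulmxA mxtrace_mulC !mulmxA.
by rewrite -!mulmxA Re_sum; apply: eq_bigr => j _; rewrite mul_rdiag_diag Re_realM mulmxA.
Qed.

Lemma sum_diag_in n (U A : 'M[C]_n) : unitary U -> \sum_j diag_in U A j = Re (\tr A).
Proof.
move=> hU; rewrite -[A in RHS]mulmx1 -(spec1 hU) Re_tr_spec.
by apply: eq_bigr => j _; rewrite mul1r.
Qed.

Lemma psdmx_adj n (A : 'M[C]_n) : psdmx A -> adjmx A = A.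
Proof. by case=> /[!hermsymmx_adj] /eqP. Qed.

Lemma diag_in_ge0 n (U A : 'M[C]_n) j : psdmx A -> 0 <= diag_in U A j.
Proof.
case=> _ /(_ (row j U)); rewrite /diag_in.
rewrite (_ : (_ *m _ *m _) 0 0 = (U *m A *m adjmx U) j j).
  by rewrite lecE => /andP[_].
rewrite -row_mul !mxE; apply: eq_bigr => k _; rewrite !mxE.
by congr (_ * _).
Qed.

Lemma diag_in_spec n (U : 'M[C]_n) r j : unitary U -> diag_in U (spec U r) j = r j.
Proof.
move=> hU; rewrite /diag_in /spec !mulmxA hU mul1mx -mulmxA hU mulmx1.
by rewrite !mxE eqxx mulr1n.
Qed.

Lemma diag_inD n (U A B : 'M[C]_n) j :
  diag_in U (A + B) j = diag_in U A j + diag_in U B j.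
Proof. by rewrite /diag_in mulmxDr mulmxDl mxE raddfD. Qed.

Lemma diag_inN n (U A : 'M[C]_n) j : diag_in U (- A) j = - diag_in U A j.
Proof. by rewrite /diag_in mulmxN mulNmx mxE raddfN. Qed.

Lemma diag_in1 n (U : 'M[C]_n) j : unitary U -> diag_in U 1%:M j = 1.
Proof. by move=> hU; rewrite /diag_in mulmx1 hU !mxE eqxx. Qed.

(** * Positive semidefinite matrices *)

Lemma psd_gram m n (A : 'M[C]_(m, n)) : psdmx (adjmx A *m A).
Proof.
split; first by rewrite hermsymmx_adj adjmx_mul adjmxK.
move=> v; rewrite mulmxA -mulmxA -{2}[A]adjmxK -adjmx_mul mxE sumr_ge0// => j _.
by rewrite adjmxE mul_conjC_ge0.
Qed.

Lemma psd_congr m n (B : 'M[C]_(m, n)) (A : 'M[C]_n) :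
  psdmx A -> psdmx (B *m A *m adjmx B).
Proof.
move=> pA; split.
  by rewrite hermsymmx_adj !adjmx_mul adjmxK (psdmx_adj pA) mulmxA.
case: pA => _ pA v; have := pA (v *m B).
by rewrite adjmx_mul !mulmxA.
Qed.

Lemma psd_spec n (U : 'M[C]_n) r : (forall j, 0 <= r j) -> psdmx (spec U r).
Proof.
move=> r0.
rewrite (_ : spec U r = adjmx (rdiag (Num.sqrt \o r) *m U) *m (rdiag (Num.sqrt \o r) *m U)).
  exact: psd_gram.
rewrite adjmx_mul adjmx_rdiag /spec !mulmxA; congr (_ *m _).
rewrite -mulmxA rdiagM; congr (_ *m _); congr rdiag; apply/funext => j /=.
by rewrite -expr2 sqr_sqrtr.
Qed.

Lemma psdD n (A B : 'M[C]_n) : psdmx A -> psdmx B -> psdmx (A + B).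
Proof.
move=> pA pB; split; first by rewrite hermsymmx_adj adjmxD !psdmx_adj.
by move=> v; rewrite mulmxDr mulmxDl mxE addr_ge0 //; [case: pA|case: pB].
Qed.

Lemma psdZ n (a : R) (A : 'M[C]_n) : 0 <= a -> psdmx A -> psdmx (a%:C *: A).
Proof.
move=> a0 pA; split; first by rewrite hermsymmx_adj adjmxZ !psdmx_adj.
case: pA => _ pA v; rewrite -scalemxAr -scalemxAl mxE mulr_ge0//.
by rewrite lecR.
Qed.

Lemma psd0 n : psdmx (0 : 'M[C]_n).
Proof.
by have := psd_gram (0 : 'M[C]_n); rewrite mulmx0.
Qed.

Lemma psd_sum (I : Type) (s : seq I) (Q : pred I) n (F : I -> 'M[C]_n) :
  (forall i, Q i -> psdmx (F i)) -> psdmx (\sum_(i <- s | Q i) F i).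
Proof.
by move=> hF; apply: (big_ind (@psdmx R n)); [exact: psd0|exact: psdD|exact: hF].
Qed.

Lemma Re_tr_psd n (A : 'M[C]_n) : psdmx A -> 0 <= Re (\tr A).
Proof.
move=> pA; rewrite -(sum_diag_in A (U := 1%:M)); last by rewrite /unitary adjmx1 mulmx1.
by apply: sumr_ge0 => j _; exact: diag_in_ge0.
Qed.

(** * Orthogonal projections *)

Definition projmx n (E : 'M[C]_n) := adjmx E = E /\ E *m E = E.

Lemma proj_compl n (E : 'M[C]_n) : projmx E -> projmx (1%:M - E).
Proof.
move=> [aE EE]; split; first by rewrite adjmxB adjmx1 aE.
by rewrite mulmxBl mul1mx mulmxBr mulmx1 EE subrr subr0.
Qed.

Lemma psd_proj n (E : 'M[C]_n) : projmx E -> psdmx E.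
Proof. by move=> [aE EE]; rewrite -EE -{1}aE; exact: psd_gram. Qed.

Lemma Re_tr_proj_ge0 n (E A : 'M[C]_n) : projmx E -> psdmx A -> 0 <= Re (\tr (E *m A)).
Proof.
move=> [aE EE] pA; rewrite -EE -mulmxA mxtrace_mulC -{2}aE.
by apply: Re_tr_psd; exact: psd_congr.
Qed.

Lemma diag_in_proj_le1 n (U E : 'M[C]_n) j : unitary U -> projmx E -> diag_in U E j <= 1.
Proof.
move=> hU /proj_compl /psd_proj /(diag_in_ge0 U j).
by rewrite diag_inD diag_inN diag_in1// subr_ge0.
Qed.

Lemma proj_spec n (U : 'M[C]_n) (Q : pred 'I_n) : unitary U ->
  projmx (spec U (fun j => (Q j)%:R)).
Proof.
move=> hU; split; first exact: spec_adj.
by rewrite specM//; apply: eq_spec => j; case: (Q j); rewrite ?mulr1 ?mulr0.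
Qed.

Lemma rank_spec n (U : 'M[C]_n) (Q : pred 'I_n) :
  (\rank (spec U (fun j => (Q j)%:R)) <= #|Q|)%N.
Proof.
rewrite /spec (leq_trans (mxrankM_maxl _ _))// (leq_trans (mxrankM_maxr _ _))//.
have -> : rdiag (fun j => (Q j)%:R) = \sum_(j in Q) delta_mx j j.
  apply/matrixP => i j; rewrite !mxE summxE.
  under eq_bigr do rewrite mxE.
  have [<-|ij] := eqVneq i j; last first.
    rewrite mulr0n big1// => k _; case: eqP => //= ik; case: eqP => //= jk.
    by rewrite ik jk eqxx in ij.
  rewrite mulr1n; case: (boolP (Q i)) => Qi.
    rewrite (bigD1 i)//= !eqxx big1 ?addr0// => k /andP[_ /negPf ki].
    by rewrite eq_sym ki.
  by rewrite big1// => k Qk; case: eqP => //= ik; case/negP: Qi; rewrite ik.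
rewrite -sum1_card; elim/big_rec2: _ => [|j m A _ h]; first by rewrite mxrank0.
by rewrite (leq_trans (mxrank_add _ _))// mxrank_delta leq_add2l.
Qed.

(** If the rows of [Q] form a basis of the row space of [B] and [G] is their Gram matrix, the
    projection is [adjmx Q *m invmx G *m Q]. By cyclicity its trace is that of an identity matrix of
    size [\rank B]. *)
Lemma ortho_proj_exists m n (B : 'M[C]_(m, n)) :
  exists E : 'M[C]_n, [/\ projmx E, B *m E = B, (E <= B)%MS &
                        Re (\tr E) = (\rank B)%:R].
Proof.
pose Q := row_base B; pose G := Q *m adjmx Q.
(* A vector [v] killed by [G] gives [v *m Q] norm zero, and the rows of [Q] are independent. *)
have uG : G \in unitmx.
  rewrite -row_free_unit -kermx_eq0; apply/eqP/row_matrixP => i; rewrite row0.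
  set v := row i _; have : v *m G = 0 by apply/sub_kermxP; exact: row_sub.
  have e : v *m G *m adjmx v = (v *m Q) *m adjmx (v *m Q).
    by rewrite adjmx_mul /G !mulmxA.
  move=> vG; move: e; rewrite vG mul0mx => /esym/matrixP/(_ 0 0).
  rewrite mxE [RHS]mxE => h.
  have vQ : v *m Q = 0.
    apply/matrixP => a b; rewrite ord1 [RHS]mxE.
    move: h => /eqP; rewrite psumr_eq0 => [/allP/(_ b)|k _].
      rewrite mem_index_enum => /(_ isT); rewrite /= adjmxE.
      by rewrite mul_conjC_eq0 => /eqP.
    by rewrite adjmxE mul_conjC_ge0.
  by apply/eqP; move/eqP: vQ; rewrite mulmx_free_eq0// row_base_free.
have aG : adjmx G = G by rewrite /G adjmx_mul adjmxK.
have aGi : adjmx (invmx G) = invmx G.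
  rewrite -[LHS]mulmx1 -(mulmxV uG) mulmxA -{2}aG -adjmx_mul mulmxV// adjmx1.
  by rewrite mul1mx.
have QG : Q *m adjmx Q = G by [].
have BQ : (B <= Q)%MS by rewrite eq_row_base.
have QB : (Q <= B)%MS by rewrite eq_row_base.
move: (invmx G) (mulmxV uG) aGi => G' GG' aG'; clearbody G Q.
have QE : Q *m (adjmx Q *m G' *m Q) = Q by rewrite !mulmxA QG GG' mul1mx.
exists (adjmx Q *m G' *m Q); split.
- split; first by rewrite !adjmx_mul adjmxK aG' mulmxA.
  by rewrite -{1}mulmxA QE.
- case/submxP: BQ => D BD.
  by have := congr1 (mulmx D) QE; rewrite (mulmxA D Q) -BD.
- by rewrite (submx_trans (submxMl _ _)).
- rewrite mxtrace_mulC mulmxA QG GG' mxtrace1.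
  by rewrite -(rmorph_nat (real_complex R)).
Qed.

(** * Trace norm *)

Lemma trace_norm_spec n (U : 'M[C]_n) r : unitary U ->
  trace_norm (spec U r) = \sum_j `|r j|.
Proof.
move=> hU; rewrite /trace_norm spec_adj specM// mx_fun_spec//.
rewrite -(sum_diag_in _ hU); apply: eq_bigr => j _.
by rewrite diag_in_spec//= -expr2 sqrtr_sqr.
Qed.

(** In an eigenbasis of [A] the diagonal of [E] lies in [0, 1], so the trace of [E *m A] is at most
    the sum of the positive eigenvalues. As [A] is traceless, that sum is half the trace norm. *)
Lemma trace_norm_ge n (A E : 'M[C]_n) : adjmx A = A -> Re (\tr A) = 0 -> projmx E ->
  2 * Re (\tr (E *m A)) <= trace_norm A.
Proof.
move=> hA + pE; have := hermitian_spec hA; have := spectralmx_unitary A.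
move: (spectralmx A) (eigv A) => U r hU -> trA.
rewrite trace_norm_spec// Re_tr_spec mulr_sumr.
have s0 : \sum_j r j = 0.
  apply: etrans trA; rewrite -(sum_diag_in _ hU).
  by apply: eq_bigr => j _; rewrite diag_in_spec.
have -> : \sum_j `|r j| = \sum_j (`|r j| + r j) by rewrite big_split/= s0 addr0.
apply: ler_sum => j _.
have e0 := diag_in_ge0 U j (psd_proj pE); have e1 := diag_in_proj_le1 j hU pE.
have [a0|a0] := ger0P (r j); nra.
Qed.

(** In an eigenbasis of [A - B] each eigenvalue is a difference of nonnegative diagonal entries of
    [A] and [B], and these entries have total sum 2. *)
Lemma trace_norm_le2 n (A B : 'M[C]_n) : density_mx A -> density_mx B ->
  trace_norm (A - B) <= 2.
Proof.
move=> [pA tA] [pB tB].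
have hD : adjmx (A - B) = A - B by rewrite adjmxB !psdmx_adj.
have := hermitian_spec hD; have := spectralmx_unitary (A - B).
move: (spectralmx (A - B)) (eigv (A - B)) => U r hU DE.
rewrite DE trace_norm_spec//.
have e j : r j = diag_in U A j - diag_in U B j.
  by rewrite -(diag_in_spec r j hU) -DE diag_inD diag_inN.
apply: (@le_trans _ _ (\sum_j (diag_in U A j + diag_in U B j))); last first.
  by rewrite big_split/= !sum_diag_in// tA tB/=; lra.
apply: ler_sum => j _; rewrite e (le_trans (ler_normB _ _))//.
by rewrite !ger0_norm ?diag_in_ge0.
Qed.

End SpectralCalculus.

(** * Tensor products along a word *)

Section TensorWords.
Variable R : realType.
Local Notation C := R[i].
Local Notation Re := (@complex.Re R).
Local Open Scope complex_scope.
Variables (X : finType) (d : nat).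
Implicit Types (A B U : X -> 'M[C]_d) (r : X -> 'I_d -> R).

(** The entrywise recursion hides the cast between sizes [d ^ n.+1] and [d * d ^ n]; later
    inductions on tensor words rest on it. *)
Lemma chan_wordS A n (x : n.+1.-tuple X) i j :
  chan_word A x i j = A (thead x) (split_index i).1 (split_index j).1 *
    chan_word A (behead_tuple x) (split_index i).2 (split_index j).2.
Proof.
case/tupleP: x => y x; rewrite /chan_word [LHS]/= castmxE /= !esymK mxE.
rewrite -/(split_index i) -/(split_index j); congr (_ * _).
by congr (tens_tuple _ _ _); apply: val_inj.
Qed.

Lemma chan_word_mul A B n (x : n.-tuple X) :
  chan_word A x *m chan_word B x = chan_word (fun y => A y *m B y) x.
Proof.
elim: n x => [|n IH] x; first by rewrite /chan_word /= mulmx1.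
apply/matrixP => i j; rewrite chan_wordS -IH !mxE big_distrlr sum_split_index.
apply: eq_bigr => a _; apply: eq_bigr => b _.
by rewrite !chan_wordS join_indexK /=; ring.
Qed.

Lemma chan_word_adj A n (x : n.-tuple X) :
  adjmx (chan_word A x) = chan_word (fun y => adjmx (A y)) x.
Proof.
elim: n x => [|n IH] x; first by rewrite /chan_word /= adjmx1.
by apply/matrixP => i j; rewrite chan_wordS -IH !adjmxE chan_wordS rmorphM.
Qed.

Lemma chan_word_rdiag r n (x : n.-tuple X) :
  chan_word (fun y => rdiag (r y)) x = rdiag (word_prod r x).
Proof.
elim: n x => [|n IH] x; first by apply/matrixP => i j; rewrite !mxE.
apply/matrixP => i j; rewrite chan_wordS IH !mxE word_prodS.
rewrite -(inj_eq (can_inj (@split_indexK d n)) i j) -pair_eqE /=.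
by do 2 case: eqP => _ /=; rewrite ?mulr1n ?mulr0n ?mulr0 ?mul0r ?rmorphM.
Qed.

Lemma chan_word_spec U r n (x : n.-tuple X) :
  chan_word (fun y => spec (U y) (r y)) x = spec (chan_word U x) (word_prod r x).
Proof. by rewrite /spec chan_word_adj -chan_word_rdiag !chan_word_mul. Qed.

Lemma chan_word_unitary U n (x : n.-tuple X) :
  (forall y, unitary (U y)) -> unitary (chan_word U x).
Proof.
move=> hU; rewrite /unitary chan_word_adj chan_word_mul.
elim: n x => [|n IH] x; first by [].
apply/matrixP => i j; rewrite chan_wordS IH hU !mxE.
rewrite -(inj_eq (can_inj (@split_indexK d n)) i j) -pair_eqE /=.
by do 2 case: eqP => _ /=; rewrite ?mulr1n ?mulr0n ?mulr0 ?mul0r ?mulr1.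
Qed.

Lemma chan_word_diag A n (x : n.-tuple X) j :
  chan_word A x j j = word_prod (fun y k => A y k k) x j.
Proof.
elim: n x j => [|n IH] x j; first by rewrite mxE ord1.
by rewrite chan_wordS IH.
Qed.

Lemma diag_in_complex n (U A : 'M[C]_n) j :
  adjmx A = A -> (U *m A *m adjmx U) j j = (diag_in U A j)%:C.
Proof.
move=> hA; rewrite /diag_in RRe_real//; apply/CrealP; rewrite -adjmxE.
by rewrite !adjmx_mul adjmxK hA mulmxA.
Qed.

(** Measuring a product in a product basis gives independent outcomes. Hermitian factors have real
    diagonal entries, so taking real parts commutes with the product. *)
Lemma diag_in_chan_word U A n (x : n.-tuple X) j : (forall y, adjmx (A y) = A y) ->
  diag_in (chan_word U x) (chan_word A x) j =
  word_prod (fun y => diag_in (U y) (A y)) x j.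
Proof.
move=> hA; rewrite /diag_in chan_word_adj !chan_word_mul chan_word_diag.
suff -> : word_prod (fun y k => (U y *m A y *m adjmx (U y)) k k) x j =
    (word_prod (fun y => diag_in (U y) (A y)) x j)%:C by [].
elim: n x j => [|n IH] x j; first by [].
by rewrite !word_prodS IH diag_in_complex// rmorphM.
Qed.

Lemma eigv_ge0 n (A : 'M[C]_n) j : psdmx A -> 0 <= eigv A j.
Proof.
move=> pA; have hA := psdmx_adj pA.
rewrite -(diag_in_spec (eigv A) j (spectralmx_unitary A)) -hermitian_spec//.
exact: diag_in_ge0.
Qed.

Lemma sum_eigv n (A : 'M[C]_n) : density_mx A -> \sum_j eigv A j = 1.
Proof.
move=> [pA tA]; have hA := psdmx_adj pA.
transitivity (Re (\tr A)); last by rewrite tA.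
rewrite -(sum_diag_in _ (spectralmx_unitary A)); apply: eq_bigr => j _.
by rewrite -[LHS](diag_in_spec _ j (spectralmx_unitary A)) -hermitian_spec.
Qed.

(** An explicit product eigenbasis, used in place of [spectralmx] of the tensor product, which need
    not have product form. *)
Lemma chan_word_eig A n (x : n.-tuple X) : (forall y, adjmx (A y) = A y) ->
  chan_word A x = spec (chan_word (fun y => spectralmx (A y)) x)
                       (word_prod (fun y => eigv (A y)) x).
Proof.
move=> hA; rewrite -chan_word_spec; congr (chan_word _ x).
by apply/funext => y; exact: hermitian_spec.
Qed.

Lemma chan_word_density A n (x : n.-tuple X) :
  (forall y, density_mx (A y)) -> density_mx (chan_word A x).
Proof.
move=> dA; split.
  rewrite chan_word_eig; last by move=> y; apply: psdmx_adj; case: (dA y).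
  apply: psd_spec => j; apply: word_prod_ge0 => y k; apply: eigv_ge0.
  by case: (dA y).
rewrite /mxtrace; under eq_bigr do rewrite chan_word_diag.
by apply: sum_word_prod => y; case: (dA y).
Qed.

End TensorWords.

(** Treats the tensor power as a word over a one-letter alphabet, so that the lemmas on words serve
    both the codewords and the target state. *)
Lemma ntensmx_chan_word (R : realType) d (A : 'M[R[i]]_d) n :
  ntensmx A n = chan_word (fun=> A) [tuple of nseq n tt].
Proof.
case: n => [|n] //; elim: n => [|n IH].
  apply/matrixP => i j; rewrite chan_wordS [chan_word _ _ _ _]mxE !ord1 mulr1.
  by rewrite ntensmx1; congr (A _ _); apply: val_inj; rewrite /= divn1.
apply/matrixP => i j; rewrite ntensmxSS chan_wordS mxE IH.
have -> : behead_tuple [tuple of nseq n.+2 tt] = [tuple of nseq n.+1 tt] by exact: val_inj.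
have e (k : 'I_(d ^ n.+2)) :
    split_index k = @mxtens_unindex d (d ^ n.+1) k by congr mxtens_unindex; apply: val_inj.
by rewrite !e.
Qed.

(** * A test separating a mixture from a state *)

Section OneShot.
Variable R : realType.
Local Notation C := R[i].
Local Notation Re := (@complex.Re R).
Local Open Scope complex_scope.

Lemma Re_trD n (A B : 'M[C]_n) : Re (\tr (A + B)) = Re (\tr A) + Re (\tr B).
Proof. by rewrite mxtraceD raddfD. Qed.

Lemma Re_trB n (A B : 'M[C]_n) : Re (\tr (A - B)) = Re (\tr A) - Re (\tr B).
Proof. by rewrite linearB raddfB. Qed.

Lemma density_mixture M n (rho : 'I_M -> 'M[C]_n) : (0 < M)%N ->
  (forall m, density_mx (rho m)) -> density_mx ((M%:R)^-1 *: \sum_(m < M) rho m).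
Proof.
move=> M0 dr; have MC : (M%:R : C) != 0 by rewrite pnatr_eq0 -lt0n.
have -> : (M%:R : C)^-1 = ((M%:R)^-1 : R)%:C by rewrite fmorphV rmorph_nat.
split; first by apply: psdZ; rewrite ?invr_ge0 ?ler0n//; apply: psd_sum => m _; case: (dr m).
rewrite linearZ/= raddf_sum/=; under eq_bigr do rewrite (dr _).2.
by rewrite sumr_const card_ord fmorphV rmorph_nat mulVf.
Qed.

Lemma Re_tr_mixture M n (E : 'M[C]_n) (rho : 'I_M -> 'M[C]_n) :
  Re (\tr (E *m ((M%:R)^-1 *: \sum_(m < M) rho m))) =
  (M%:R)^-1 * \sum_(m < M) Re (\tr (E *m rho m)).
Proof.
have -> : (M%:R : C)^-1 = ((M%:R)^-1 : R)%:C by rewrite fmorphV rmorph_nat.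
rewrite -scalemxAr mxtraceZ; rewrite Re_realM; congr (_ * _).
by rewrite mulmx_sumr -Re_sum; congr complex.Re; exact: raddf_sum.
Qed.

(* A projection commuting with [rho] splits it into two blocks, the first of
   which is annihilated by [F]. *)
Lemma Re_tr_proj_block n (F T rho : 'M[C]_n) : psdmx rho -> projmx F -> projmx T ->
    T *m rho = rho *m T -> T *m F = 0 ->
  Re (\tr (F *m rho)) <= Re (\tr ((1%:M - T) *m rho)).
Proof.
move=> pr pF pT Tr TF; have [aF FF] := pF; have [aT TT] := pT.
have FT : F *m T = 0.
  by rewrite -aF -aT -adjmx_mul TF; apply/matrixP => i j; rewrite adjmxE !mxE conjC0.
pose Y := 1%:M - T; have [aY YY] : projmx Y := proj_compl pT.
have FY : F *m Y = F by rewrite mulmxBr mulmx1 FT subr0.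
have Yr : Y *m rho *m Y = Y *m rho.
  rewrite -mulmxA -[X in _ *m X](_ : Y *m rho = _) ?mulmxA ?YY//.
  by rewrite mulmxBr mulmxBl mulmx1 mul1mx Tr.
have pYr : psdmx (Y *m rho) by rewrite -Yr -{2}aY; exact: psd_congr.
(* [F] sees only the positive block [Y *m rho], and a projection cannot increase its trace. *)
rewrite -/Y -FY -mulmxA -subr_ge0 -Re_trB -{1}[Y *m rho]mul1mx -mulmxBl.
exact: Re_tr_proj_ge0 (proj_compl pF) pYr.
Qed.

(** Here [a] bounds the error on each codeword state, [b] the weight of [spec U lam] outside [P],
    and [b'] its weight on eigenvalues outside [S]. The last term bounds what a projection of rank
    at most [M * r] captures of eigenvalues at most [c]. *)
Lemma separating_test M n (rho T : 'I_M -> 'M[C]_n) (U P : 'M[C]_n)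
    (lam : 'I_n -> R) (S : pred 'I_n) (near : pred 'I_M) (a b b' c r : R) :
    (0 < M)%N -> (forall m, density_mx (rho m)) ->
    unitary U -> (forall j, 0 <= lam j) -> \sum_j lam j = 1 -> 0 <= c -> 0 <= r ->
    projmx P ->
    (forall m, projmx (T m)) -> (forall m, T m *m rho m = rho m *m T m) ->
    (forall m, near m -> (\rank (T m))%:R <= r) ->
    (forall m, near m -> Re (\tr ((1%:M - T m) *m rho m)) <= a) ->
    (forall m, ~~ near m -> Re (\tr (P *m rho m)) <= a) ->
    Re (\tr ((1%:M - P) *m spec U lam)) <= b ->
    (forall j, S j -> lam j <= c) ->
    \sum_(j | ~~ S j) lam j <= b' ->
  1 - a - b - b' - c * (M%:R * r) <=
    trace_norm ((M%:R)^-1 *: \sum_(m < M) rho m - spec U lam) / 2.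
Proof.
move=> M0 dr hU lam0 lam1 c0 r0 pP pT Tr rkT Ta Pa Pb Sc Sb.
pose B := (\sum_(m | near m) <<T m *m P>>)%MS.
have [E [pE BE EB trE]] := ortho_proj_exists B.
have [aP PP] := pP; have [aE EE] := pE.
(* All rows of [B] lie in the range of [P], so [E] is a subprojection of [P] and [P - E] is again a
   projection. *)
have BP : (B <= P)%MS by apply/sumsmx_subP => m _; rewrite genmxE submxMl.
have EP : E *m P = E.
  by have /submxP[D ->] := submx_trans EB BP; rewrite -mulmxA PP.
have PE : P *m E = E by rewrite -{1}aP -{1}aE -adjmx_mul EP.
have TPE m : near m -> T m *m P *m E = T m *m P.
  move=> nm; have /submxP[D ->] : (T m *m P <= B)%MS.
    by rewrite (sumsmx_sup m)// genmxE.
  by rewrite -mulmxA BE.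
have rkB : (\rank B)%:R <= M%:R * r.
  have : (\rank B <= \sum_(m | near m) \rank (T m))%N.
    rewrite /B; elim/big_rec2: _ => [|m k D _ h]; first by rewrite mxrank0.
    rewrite (leq_trans (mxrank_adds_leqif _ _).1)// leq_add//.
    by rewrite genmxE mxrankM_maxl.
  rewrite -(ler_nat R) => /le_trans; apply; rewrite natr_sum.
  apply: (@le_trans _ _ (\sum_(m | near m) r)); first exact: ler_sum.
  rewrite big_mkcond/= (le_trans (y := \sum_(m < M) r))//.
    by apply: ler_sum => m _; case: ifP.
  by rewrite sumr_const card_ord mulr_natl.
pose F := P - E.
have pF : projmx F.
  split; first by rewrite /F adjmxB aP aE.
  by rewrite /F mulmxBl !mulmxBr PP PE EP EE subrr subr0.
(* For near [m], [T m] annihilates [F] because [E] fixes the rows of [T m *m P]; for far [m], [F] is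
   dominated by [P]. *)
have Fa m : Re (\tr (F *m rho m)) <= a.
  have [nm|nm] := boolP (near m).
    apply: le_trans (Ta m nm); apply: Re_tr_proj_block => //; first by case: (dr m).
    by rewrite /F mulmxBr -{1}PE mulmxA TPE// subrr.
  apply: le_trans (Pa m nm); rewrite /F mulmxBl Re_trB gerBl.
  by apply: Re_tr_proj_ge0 => //; case: (dr m).
(* Outside [S] bound the diagonal of [E] by 1; on [S] bound the eigenvalues by [c] and the diagonal
   of [E] by its trace, the rank of [B]. *)
have Eb : Re (\tr (E *m spec U lam)) <= b' + c * (M%:R * r).
  rewrite Re_tr_spec (bigID S)/= addrC; apply: lerD.
    apply: le_trans Sb; apply: ler_sum => j _.
    by rewrite ler_piMr// diag_in_proj_le1.
  apply: (@le_trans _ _ (c * \sum_j diag_in U E j)); last first.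
    by rewrite sum_diag_in// trE ler_wpM2l.
  rewrite mulr_sumr [leRHS](bigID S)/= ler_wpDr//.
    by apply: sumr_ge0 => j _; rewrite mulr_ge0// diag_in_ge0//; exact: psd_proj.
  apply: ler_sum => j Sj; apply: ler_wpM2r; last exact: Sc.
  by apply: diag_in_ge0; exact: psd_proj.
have dC := density_mixture M0 dr.
have trs : Re (\tr (spec U lam)) = 1.
  by rewrite -(sum_diag_in _ hU) -lam1; apply: eq_bigr => j _; rewrite diag_in_spec.
set rC := _^-1 *: _ in dC *.
have M0' : (0 : R) < M%:R by rewrite ltr0n.
have FC : Re (\tr (F *m rC)) <= a.
  rewrite Re_tr_mixture ler_pdivrMl// mulrC.
  apply: (@le_trans _ _ (\sum_(m < M) a)); first exact: ler_sum.
  by rewrite sumr_const card_ord mulr_natr.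
rewrite ler_pdivlMr// mulrC.
have hD : adjmx (rC - spec U lam) = rC - spec U lam.
  by rewrite adjmxB spec_adj psdmx_adj//; case: dC.
have trD : Re (\tr (rC - spec U lam)) = 0 by rewrite Re_trB trs dC.2 subrr.
(* The test is [1 - F = 1 - P + E]. *)
apply: le_trans (trace_norm_ge hD trD (proj_compl pF)).
rewrite ler_pM2l// mulmxBr Re_trB.
have cF A : Re (\tr ((1%:M - F) *m A)) = Re (\tr A) - Re (\tr (F *m A)).
  by rewrite mulmxBl mul1mx Re_trB.
have trC : Re (\tr rC) = 1 by rewrite dC.2.
rewrite !cF trs trC; clear -FC Eb Pb pF trs.
have : Re (\tr (F *m spec U lam)) = 1 - Re (\tr ((1%:M - P) *m spec U lam))
    - Re (\tr (E *m spec U lam)).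
  by rewrite /F !mulmxBl mul1mx !Re_trB trs; ring.
move: (Re _) (Re _) FC Eb Pb (Re _) => x y FC Eb z Pb ->; lra.
Qed.

End OneShot.

(** * The test for a code of block length [n] *)

Section BlockTest.
Variable R : realType.
Local Notation C := R[i].
Local Notation Re := (@complex.Re R).

(** Lets the same tensor power of an eigenbasis be read along any codeword or along the word of
    units. *)
Lemma chan_word_const (X Y : finType) d (A : 'M[C]_d) n (x : n.-tuple X) (y : n.-tuple Y) :
  chan_word (fun=> A) x = chan_word (fun=> A) y.
Proof.
elim: n x y => [|n IH] x y; first by [].
by apply/matrixP => i j; rewrite !chan_wordS (IH _ (behead_tuple y)).
Qed.

Lemma word_sum_const (X Y : Type) d (f : 'I_d -> R) n (x : n.-tuple X) (y : n.-tuple Y) :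
  word_sum (fun=> f) x = word_sum (fun=> f) y.
Proof.
elim: n x y => [|n IH] x y; first by [].
by apply/funext => j; rewrite !word_sumS (IH _ (behead_tuple y)).
Qed.

Lemma spec_compl n (U : 'M[C]_n) (Q : pred 'I_n) : unitary U ->
  1%:M - spec U (fun j => (Q j)%:R) = spec U (fun j => (~~ Q j)%:R).
Proof.
move=> hU; apply/eqP; rewrite subr_eq specD; apply/eqP.
rewrite -(spec1 hU); apply: eq_spec => j.
by case: (Q j); rewrite ?addr0 ?add0r.
Qed.

Lemma Re_tr_spec_pred n (U A : 'M[C]_n) (Q : pred 'I_n) :
  Re (\tr (spec U (fun j => (Q j)%:R) *m A)) = \sum_(j | Q j) diag_in U A j.
Proof.
rewrite mxtrace_mulC Re_tr_spec [RHS]big_mkcond; apply: eq_bigr => j _.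
by case: (Q j); rewrite ?mul1r ?mul0r.
Qed.

(** Only an inequality, since [ln 0 = 0]: a zero factor on the left corresponds to a factor 1 on the
    right. *)
Lemma word_prod_le_exp (X : Type) d (f : X -> 'I_d -> R) n (x : n.-tuple X) j :
  (forall y k, 0 <= f y k) ->
  word_prod f x j <= expR (word_sum (fun y k => ln (f y k)) x j).
Proof.
move=> f0; elim: n x j => [|n IH] x j; first by rewrite /= expR0.
rewrite word_prodS word_sumS expRD ler_pM ?f0 ?word_prod_ge0//.
have [->|fn0] := eqVneq (f (thead x) (split_index j).1) 0; first exact: expR_ge0.
by rewrite lnK// posrE lt_neqAle eq_sym fn0 f0.
Qed.

Lemma word_prod_exp (X : Type) d (f : X -> 'I_d -> R) n (x : n.-tuple X) j :
  (forall y k, 0 <= f y k) -> word_prod f x j != 0 ->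
  word_prod f x j = expR (word_sum (fun y k => ln (f y k)) x j).
Proof.
move=> f0; elim: n x j => [|n IH] x j; first by rewrite /= expR0.
rewrite word_prodS word_sumS mulf_eq0 negb_or => /andP[fn0 pn0].
rewrite expRD -IH// lnK// posrE lt_neqAle eq_sym fn0 f0//.
Qed.

(** For a density matrix, minus the von Neumann entropy, in natural logarithms. *)
Definition neg_entropy d (A : 'M[C]_d) : R := \sum_k eigv A k * ln (eigv A k).

(** Variance of the logarithm of an eigenvalue drawn with probability equal to itself. Zero
    eigenvalues have weight zero, so the value of [ln 0] is harmless. *)
Definition eig_var d (A : 'M[C]_d) : R :=
  \sum_k eigv A k * (ln (eigv A k) - neg_entropy A) ^+ 2.

(** Variance of the outcome when a Hermitian [L] is measured in the state [A]. *)
Definition obs_var d (A L : 'M[C]_d) : R :=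
  \sum_k diag_in (spectralmx L) A k * (eigv L k - Re (\tr (A *m L))) ^+ 2.

Lemma obs_mean d (A L : 'M[C]_d) : adjmx L = L ->
  \sum_k diag_in (spectralmx L) A k * eigv L k = Re (\tr (A *m L)).
Proof.
move=> hL; transitivity (Re (\tr (A *m spec (spectralmx L) (eigv L)))).
  by rewrite Re_tr_spec; apply: eq_bigr => k _; rewrite mulrC.
by rewrite -hermitian_spec.
Qed.

Section Words.
Variables (X : finType) (d : nat) (W : X -> 'M[C]_d) (n : nat) (x : n.-tuple X).
Hypotheses (dW : forall y, density_mx (W y)) (n0 : (0 < n)%N).
Variables (e V : R).
Hypothesis (e0 : 0 < e).

Let pW y : psdmx (W y) := (dW y).1.
Let hW y : adjmx (W y) = W y := psdmx_adj (pW y).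

(** The numbers [word_sum (fun=> eigv L) x j] are the eigenvalues of L_1 + ... + L_n in the tensor
    power of the eigenbasis of [L]; on a product state this measurement is a sum of independent
    outcomes. *)
Lemma obs_tail (L : 'M[C]_d) (Q : pred 'I_(d ^ n)) :
    adjmx L = L -> (forall y, obs_var (W y) L <= V) ->
    (forall j, Q j ->
      n%:R * e <= `|word_sum (fun=> eigv L) x j - \sum_(y <- x) Re (\tr (W y *m L))|) ->
  Re (\tr (spec (chan_word (fun=> spectralmx L) x) (fun j => (Q j)%:R) *m chan_word W x))
    <= V / (n%:R * e ^+ 2).
Proof.
move=> hL vL hQ; rewrite Re_tr_spec_pred.
under eq_bigr do rewrite diag_in_chan_word//.
apply: (@word_sum_chebyshev X d R _ (fun=> eigv L)) => //.
- by move=> y k; exact: diag_in_ge0.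
- move=> y; rewrite sum_diag_in; last exact: spectralmx_unitary.
  by rewrite (dW y).2.
- by move=> y; rewrite obs_mean//; exact: vL.
- move=> j /hQ; suff -> : \sum_(y <- x) Re (\tr (W y *m L)) =
    \sum_(y <- x) \sum_k diag_in (spectralmx L) (W y) k * eigv L k by [].
  by apply: eq_bigr => y _; rewrite obs_mean.
Qed.

Lemma eig_tail (Q : pred 'I_(d ^ n)) : (forall y, eig_var (W y) <= V) ->
    (forall j, Q j -> n%:R * e <=
      `|word_sum (fun y k => ln (eigv (W y) k)) x j - \sum_(y <- x) neg_entropy (W y)|) ->
  \sum_(j | Q j) word_prod (fun y => eigv (W y)) x j <= V / (n%:R * e ^+ 2).
Proof.
move=> vW hQ; apply: (@word_sum_chebyshev X d R _ (fun y k => ln (eigv (W y) k))) => //.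
- by move=> y k; exact: eigv_ge0.
- by move=> y; exact: sum_eigv.
Qed.

(* Eigenvectors of [chan_word W x] whose eigenvalue is at least about the
   typical one; a zero eigenvalue never qualifies. *)
Definition large_eig : pred 'I_(d ^ n) := fun j =>
  expR (\sum_(y <- x) neg_entropy (W y) - n%:R * e) <= word_prod (fun y => eigv (W y)) x j.

(** The eigenvalues sum to 1 and each counted one is at least the threshold. *)
Lemma card_large_eig : #|large_eig|%:R <= expR (n%:R * e - \sum_(y <- x) neg_entropy (W y)).
Proof.
set c := \sum_(y <- x) _; rewrite -[leRHS]mul1r -opprB expRN ler_pdivlMr ?expR_gt0//.
have p0 j : 0 <= word_prod (fun y => eigv (W y)) x j.
  by apply: word_prod_ge0 => y k; exact: eigv_ge0.
have p1 : \sum_j word_prod (fun y => eigv (W y)) x j = 1.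
  by apply: sum_word_prod => y; exact: sum_eigv.
rewrite -[leRHS]p1 [leRHS](bigID large_eig)/= ler_wpDr ?sumr_ge0//.
rewrite -sum1_card natr_sum mulr_suml.
by apply: ler_sum => j hj; rewrite mul1r.
Qed.

Lemma large_eig_tail : (forall y, eig_var (W y) <= V) ->
  \sum_(j | ~~ large_eig j) word_prod (fun y => eigv (W y)) x j <= V / (n%:R * e ^+ 2).
Proof.
move=> vW; set p := word_prod _ _.
(* Zero eigenvalues carry no weight; they are removed because the exponential formula for the
   product fails there. *)
rewrite (bigID (fun j => p j == 0))/= big1 ?add0r; last by move=> j /andP[_ /eqP].
apply: eig_tail => // j /andP[+ pj]; rewrite /large_eig -ltNge -/p.
have p0 y k : 0 <= eigv (W y) k by exact: eigv_ge0.
rewrite /p word_prod_exp// ltr_expR => h.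
by rewrite distrC (le_trans _ (ler_norm _))//; lra.
Qed.

End Words.

Lemma sum_tuple_const (T : Type) n (x : n.-tuple T) (a : R) :
  \sum_(y <- x) a = n%:R * a.
Proof. by rewrite big_const_seq count_predT size_tuple iter_addr_0 mulr_natl. Qed.

(** The three Chebyshev terms are the codeword error, the weight of the target outside [P], and its
    atypical eigenvalues. In the exponent, [s + e] comes from the typical eigenvalues and
    [3 * e - kappa] from the ranks. *)
Lemma block_test (X : finType) d (W : X -> 'M[C]_d) (sigma L : 'M[C]_d) n M
    (cb : 'I_M -> n.-tuple X) (e V kappa : R) :
    (forall y, density_mx (W y)) -> density_mx sigma -> adjmx L = L ->
    0 < e -> (0 < n)%N -> (0 < M)%N ->
    (forall y, kappa + (Re (\tr (W y *m L)) - Re (\tr (sigma *m L))) <= neg_entropy (W y)) ->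
    (forall y, eig_var (W y) <= V) -> eig_var sigma <= V ->
    (forall y, obs_var (W y) L <= V) -> obs_var sigma L <= V ->
  1 - 3 * (V / (n%:R * e ^+ 2)) -
    M%:R * expR (n%:R * (neg_entropy sigma - kappa + 4 * e)) <=
  trace_norm (code_state W cb - ntensmx sigma n) / 2.
Proof.
move=> dW ds hL e0 n0 M0 hk vW vs oW os.
set ls := Re (\tr (sigma *m L)) in hk *; pose l y := Re (\tr (W y *m L)).
pose tn := [tuple of nseq n tt]; pose s := neg_entropy sigma.
have hs := psdmx_adj ds.1.
have hWy y : adjmx (W y) = W y by apply: psdmx_adj; case: (dW y).
pose a := V / (n%:R * e ^+ 2).
pose UL := chan_word (fun=> spectralmx L) tn.
have uL : unitary UL by apply: chan_word_unitary => y; exact: spectralmx_unitary.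
pose QP : pred 'I_(d ^ n) := fun j => n%:R * (ls - e) <= word_sum (fun=> eigv L) tn j.
pose UW m := chan_word (fun y => spectralmx (W y)) (cb m).
have uW m : unitary (UW m) by apply: chan_word_unitary => y; exact: spectralmx_unitary.
pose Us := chan_word (fun=> spectralmx sigma) tn.
have us : unitary Us by apply: chan_word_unitary => y; exact: spectralmx_unitary.
have WE m : chan_word W (cb m) = spec (UW m) (word_prod (fun y => eigv (W y)) (cb m)).
  exact: chan_word_eig.
pose QT m : pred 'I_(d ^ n) := large_eig W (cb m) e.
pose S : pred 'I_(d ^ n) := fun j =>
  word_sum (fun _ k => ln (eigv sigma k)) tn j <= n%:R * (s + e).
(* The threshold of [QP] lies [n * e] below the mean for [sigma] and [n * e] above the cutoff for
   [near], leaving a deviation of [n * e] on both sides. *)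
pose near : pred 'I_M := fun m => n%:R * (ls - 2 * e) <= \sum_(y <- cb m) l y.
have sE : ntensmx sigma n = spec Us (word_prod (fun=> eigv sigma) tn).
  by rewrite ntensmx_chan_word (chan_word_eig tn (A := fun=> sigma)).
have := @separating_test R M _ (fun m => chan_word W (cb m))
  (fun m => spec (UW m) (fun j => (QT m j)%:R)) Us (spec UL (fun j => (QP j)%:R))
  (word_prod (fun=> eigv sigma) tn) S near a a a (expR (n%:R * (s + e)))
  (expR (n%:R * (3 * e - kappa))) M0.
rewrite -sE => key.
have -> : 1 - 3 * (V / (n%:R * e ^+ 2)) -
    M%:R * expR (n%:R * (neg_entropy sigma - kappa + 4 * e)) =
    1 - a - a - a - expR (n%:R * (s + e)) * (M%:R * expR (n%:R * (3 * e - kappa))).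
  rewrite (_ : n%:R * (neg_entropy sigma - kappa + 4 * e) =
     n%:R * (s + e) + n%:R * (3 * e - kappa)); last by rewrite /s; ring.
  by rewrite expRD /a; ring.
apply: key => //.
- by move=> m; exact: chan_word_density.
- by move=> j; apply: word_prod_ge0 => _ k; apply: eigv_ge0; case: ds.
- by apply: sum_word_prod => _; exact: sum_eigv.
- exact: proj_spec.
- by move=> m; exact: proj_spec.
- by move=> m; rewrite WE !specM//; apply: eq_spec => j; rewrite mulrC.
(* The count costs [n * e] and nearness [2 * n * e]; summing the dual inequality over the letters
   supplies [- n * kappa]. *)
- move=> m nm; apply: (@le_trans _ _ #|QT m|%:R); first by rewrite ler_nat rank_spec.
  apply: le_trans (card_large_eig (cb m) dW e) _; rewrite ler_expR.
  have h : \sum_(y <- cb m) (kappa + (l y - ls)) <= \sum_(y <- cb m) neg_entropy (W y).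
    by apply: ler_sum => y _; exact: hk.
  move: h nm; rewrite big_split sumrB /= !sum_tuple_const /near; lra.
- move=> m nm; rewrite spec_compl// Re_tr_spec_pred.
  under eq_bigr do rewrite WE diag_in_spec//.
  exact: large_eig_tail.
- move=> m; rewrite /near -ltNge => nm.
  rewrite /UL (chan_word_const _ tn (cb m)); apply: obs_tail => // j.
  rewrite /QP (word_sum_const _ tn (cb m)) => h.
  by apply: le_trans (ler_norm _); rewrite -/l; lra.
- rewrite spec_compl// ntensmx_chan_word; apply: obs_tail => // j.
  rewrite /QP -ltNge sum_tuple_const -/ls distrC => h.
  by apply: le_trans (ler_norm _); lra.
- move=> j; rewrite /S -ler_expR; apply: le_trans.
  by apply: word_prod_le_exp => _ k; apply: eigv_ge0; case: ds.
- apply: (@eig_tail unit d (fun=> sigma) n tn) => // j.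
  rewrite /S -ltNge sum_tuple_const -/s => h.
  by apply: le_trans (ler_norm _); lra.
Qed.

End BlockTest.

(** * Duality for the minimal mutual information *)

Section Duality.
Variable R : realType.
Local Notation C := R[i].
Local Notation Re := (@complex.Re R).
Local Notation Im := (@complex.Im R).
Local Open Scope complex_scope.

Lemma Im_sum (I : Type) (s : seq I) (Q : pred I) (F : I -> C) :
  Im (\sum_(i <- s | Q i) F i) = \sum_(i <- s | Q i) Im (F i).
Proof. exact: raddf_sum. Qed.

Lemma Im_realM (x : R) (z : C) : Im (x%:C * z) = x * Im z.
Proof. by case: z => a b /=; rewrite mul0r addr0. Qed.

Lemma gordan_fin (J X : finType) (u : X -> J -> R) :
  (exists y : J -> R, forall x, 0 < \sum_j y j * u x j) \/
  (exists q : X -> R, [/\ forall x, 0 <= q x, 0 < \sum_x q x &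
     forall j, \sum_x q x * u x j = 0]).
Proof.
have [[y hy]|[q [q0 q1 qu]]] := gordan (fun x (k : 'I_#|J|) => u x (enum_val k)).
  left; exists (y \o enum_rank) => x; apply: lt_le_trans (hy x) _.
  rewrite (reindex (@enum_val J predT))/=; last exact/onW_bij/enum_val_bij.
  by rewrite le_eqVlt; apply/orP; left; apply/eqP/eq_bigr => k _; rewrite enum_valK.
by right; exists q; split=> // j; have := qu (enum_rank j);
  under eq_bigr do rewrite enum_rankK.
Qed.

Lemma chan_avg_density (X : finType) d (W : X -> 'M[C]_d) q :
  (forall x, density_mx (W x)) -> is_distr q -> density_mx (chan_avg W q).
Proof.
move=> dW [q0 q1]; split.
  by apply: psd_sum => x _; apply: psdZ => //; case: (dW x).
rewrite /chan_avg raddf_sum/=.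
under eq_bigr do rewrite mxtraceZ (dW _).2 mulr1.
by rewrite -rmorph_sum/= q1.
Qed.

Lemma Re_tr_chan_avg (X : finType) d (W : X -> 'M[C]_d) q (B : 'M[C]_d) :
  Re (\tr (chan_avg W q *m B)) = \sum_x q x * Re (\tr (W x *m B)).
Proof.
rewrite /chan_avg mulmx_suml.
have -> : \tr (\sum_x (q x)%:C *: W x *m B) = \sum_x (q x)%:C * \tr (W x *m B).
  by rewrite raddf_sum/=; apply: eq_bigr => x _; rewrite -scalemxAl mxtraceZ.
by rewrite Re_sum; apply: eq_bigr => x _; rewrite Re_realM.
Qed.

Lemma Re_tr_log2 d (A : 'M[C]_d) : adjmx A = A ->
  Re (\tr (A *m mx_fun (@log2 R) A)) = neg_entropy A / ln 2.
Proof.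
move=> hA; rewrite mx_funE Re_tr_spec mulr_suml; apply: eq_bigr => j _.
have := diag_in_spec (eigv A) j (spectralmx_unitary A).
by rewrite -hermitian_spec// => ->; rewrite /= /log2; ring.
Qed.

(** The cross terms add up to Tr W(q) log W(q) by linearity. For a fixed output [chan_avg W q] the
    mutual information is therefore affine in [q]. *)
Lemma mutual_infoE (X : finType) d (W : X -> 'M[C]_d) q :
  (forall x, density_mx (W x)) -> is_distr q ->
  mutual_info W q =
    (\sum_x q x * neg_entropy (W x) - neg_entropy (chan_avg W q)) / ln 2.
Proof.
move=> dW dq; have hs := psdmx_adj (chan_avg_density dW dq).1.
rewrite mulrBl -Re_tr_log2// Re_tr_chan_avg mulr_suml -sumrB.
apply: eq_bigr => x _; rewrite /rel_entropy mulmxBr Re_trB mulrBr -mulrA.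
by rewrite -Re_tr_log2//; apply: psdmx_adj; case: (dW x).
Qed.

Lemma Re_tr_adj d (A K : 'M[C]_d) : adjmx A = A ->
  Re (\tr (A *m adjmx K)) = Re (\tr (A *m K)).
Proof.
move=> hA; rewrite -{1}hA -adjmx_mul mxtrace_mulC /mxtrace !Re_sum.
by apply: eq_bigr => i _; rewrite adjmxE; case: (_ i i).
Qed.

(** Apply Gordan's theorem to the vectors made of [h x - hb + e] and the real coordinates of
    [W x - sg]. Nonnegative weights annihilating them would normalise to a distribution with output
    [sg] and value [hb - e], against minimality. *)
Lemma dual_observable (X : finType) d (W : X -> 'M[C]_d) (p h : X -> R) (e : R) :
    (forall x, adjmx (W x) = W x) -> is_distr p -> 0 < e ->
    (forall q, is_distr q -> chan_avg W q = chan_avg W p ->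
      \sum_x p x * h x <= \sum_x q x * h x) ->
  exists L : 'M[C]_d, adjmx L = L /\ forall x,
    (\sum_y p y * h y - e) + (Re (\tr (W x *m L)) - Re (\tr (chan_avg W p *m L))) <= h x.
Proof.
move=> hW [p0 p1] e0 pmin; set sg := chan_avg W p; set hb := \sum_y _.
have hs : adjmx sg = sg.
  by rewrite /sg /chan_avg adjmx_sum; apply: eq_bigr => x _; rewrite adjmxZ hW.
pose u x (t : unit + 'I_d * 'I_d * bool) : R :=
  if t is inr (i, j, b) then
    if b then Re ((W x - sg) i j) else Im ((W x - sg) i j)
  else h x - hb + e.
have [[y hy]|[q [q0 q1 qu]]] := gordan_fin u; last first.
  exfalso; pose Q := \sum_x q x; pose q' x := q x / Q.
  have Qn0 : Q != 0 by rewrite gt_eqF.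
  have dq : is_distr q'.
    split=> [x|]; first by rewrite divr_ge0// ltW.
    by rewrite -mulr_suml divff.
  have q'0 (F : X -> R) : \sum_x q x * F x = 0 -> \sum_x q' x * F x = 0.
    move=> h0; transitivity ((\sum_x q x * F x) / Q); last by rewrite h0 mul0r.
    by rewrite mulr_suml; apply: eq_bigr => x _; rewrite /q'; ring.
  have Wq : chan_avg W q' = sg.
    have z : \sum_x (q' x)%:C *: (W x - sg) = 0.
      apply/matrixP => i j; rewrite summxE [RHS]mxE.
      apply/eqP; rewrite eq_complex; apply/andP; split; apply/eqP.
        apply: etrans (q'0 _ (qu (inr (i, j, true)))); rewrite Re_sum.
        by apply: eq_bigr => x _; rewrite mxE Re_realM.
      apply: etrans (q'0 _ (qu (inr (i, j, false)))); rewrite Im_sum.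
      by apply: eq_bigr => x _; rewrite mxE Im_realM.
    move: z; under eq_bigr do rewrite scalerBr; rewrite sumrB -scaler_suml -rmorph_sum/=.
    by rewrite dq.2 scale1r => /eqP; rewrite subr_eq0 => /eqP.
  have := pmin _ dq Wq; rewrite -/hb.
  have := q'0 _ (qu (inl tt)); rewrite /u.
  have -> : \sum_x q' x * (h x - hb + e) = \sum_x q' x * h x - hb + e.
    under eq_bigr do rewrite -addrA mulrDr.
    by rewrite big_split/= -mulr_suml dq.2 mul1r addrA.
  lra.
pose t := y (inl tt).
(* Transposed and conjugated, the coefficients [y] turn the real linear functional into the real
   part of a trace against [K]. *)
pose K : 'M[C]_d := \matrix_(j, i) (y (inr (i, j, true)) -i* y (inr (i, j, false))).
have fE x : \sum_k y k * u x k = t * (h x - hb + e) + Re (\tr ((W x - sg) *m K)).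
  rewrite big_sumType (big_pred1 tt)//; congr (_ + _).
  transitivity (\sum_i \sum_j \sum_b y (inr (i, j, b)) * u x (inr (i, j, b))).
    by rewrite pair_bigA pair_bigA; apply: eq_bigr => -[[i j] b].
  rewrite /mxtrace Re_sum; apply: eq_bigr => i _.
  rewrite [in RHS]mxE Re_sum; apply: eq_bigr => j _.
  rewrite big_bool /u [K _ _]mxE; case: ((W x - sg) i j) => a b /=; ring.
have Kavg : \sum_x p x * Re (\tr ((W x - sg) *m K)) = 0.
  under eq_bigr do rewrite mulmxBl Re_trB mulrBr.
  by rewrite sumrB -mulr_suml p1 mul1r -Re_tr_chan_avg subrr.
(* Averaged over [p], the matrix part vanishes and [t * e] remains; this is where the slack [e] is
   needed. *)
have t0 : 0 < t.
  have : 0 < \sum_x p x * \sum_k y k * u x k.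
    have F0 x : true -> 0 <= p x * \sum_k y k * u x k by rewrite mulr_ge0// ltW.
    rewrite lt_neqAle sumr_ge0// andbT; apply/eqP => /esym /(psumr_eq0P F0) z.
    suff : \sum_x p x = 0 by move/eqP; rewrite p1 oner_eq0.
    apply: big1 => x _; have /eqP := z x isT.
    by rewrite mulf_eq0 (gt_eqF (hy x)) orbF => /eqP.
  under eq_bigr do rewrite fE mulrDr.
  rewrite big_split/= Kavg addr0.
  have -> : \sum_x p x * (t * (h x - hb + e)) = t * e.
    transitivity (t * (\sum_x p x * h x + (e - hb) * \sum_x p x)).
      rewrite !mulr_sumr -big_split mulr_sumr /=.
      by apply: eq_bigr => x _; ring.
    by rewrite p1 -/hb; ring.
  by rewrite pmulr_lgt0.
(* The Hermitian part of [K] gives the same real traces against Hermitian matrices; the factor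
   normalises [t] to 1 and moves the term to the other side. *)
pose L := (- (2 * t)^-1)%:C *: (K + adjmx K).
exists L; split; first by rewrite /L adjmxZ adjmxD adjmxK addrC.
move=> x; rewrite -Re_trB -mulmxBl.
have hv : adjmx (W x - sg) = W x - sg by rewrite adjmxB hW hs.
have -> : Re (\tr ((W x - sg) *m L)) = - t^-1 * Re (\tr ((W x - sg) *m K)).
  rewrite /L -scalemxAr mxtraceZ Re_realM mulmxDr Re_trD Re_tr_adj//.
  by field; rewrite gt_eqF.
have := hy x; rewrite fE => /(mulr_gt0 (_ : 0 < t^-1)); rewrite invr_gt0 => /(_ t0).
rewrite mulrDr mulKf ?gt_eqF//; lra.
Qed.

End Duality.

(** * Limits *)

Section Limits.
Variable R : realType.
Local Open Scope classical_set_scope.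

(** The liminf is the supremum of the tail infima, so any [b] strictly above it is undercut in every
    tail. Such [n] are only frequent, which suffices for a limsup. *)
Lemma limn_einf_lt_frequently (v : nat -> R) (a : R) :
    (limn_einf (fun n => (v n)%:E) < a%:E)%E ->
  exists2 b, b < a & forall N, exists2 n, (N <= n)%N & v n < b.
Proof.
set u := fun n => _; rewrite limn_einf_lim (cvg_lim _ (@cvg_einfs_sup _ u))// => h.
have [b ba sb] : exists2 b, b < a & (ereal_sup (range (einfs u)) < b%:E)%E.
  case: (ereal_sup _) h => [r| |]//; rewrite ?lte_fin => ra.
    by exists ((r + a) / 2); rewrite ?lte_fin; lra.
  (* The liminf is [-oo] here, and any number below [a] will do. *)
  by exists (a - 1); rewrite ?ltNyr//; lra.
exists b => // N.
have : (einfs u N < b%:E)%E.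
  by apply: le_lt_trans sb; apply: ereal_sup_ubound; exists N.
by move=> /ereal_inf_lt[_ [n /= Nn <-]]; rewrite lte_fin; exists n.
Qed.

Lemma limn_esup_eq1 (v : nat -> R) : (forall n, v n <= 1) ->
    (forall e N, 0 < e -> exists2 n, (N <= n)%N & 1 - e <= v n) ->
  limn_esup (fun n => (v n)%:E) = 1%E.
Proof.
move=> v1 hv; set u := fun n => _.
rewrite limn_esup_lim (cvg_lim _ (@cvg_esups_inf _ u))//.
apply/eqP; rewrite eq_le; apply/andP; split.
  apply: (@le_trans _ _ (esups u 0%N)); first by apply: ereal_inf_lbound; exists 0%N.
  by apply: ge_ereal_sup => _ [n _ <-]; rewrite lee_fin.
apply: le_ereal_inf_tmp => _ [N _ <-]; apply/lee_addgt0Pr => e e0.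
have [n Nn hn] := hv e N e0.
rewrite -leeBlDr//; apply: (@le_trans _ _ (u n)); first by rewrite lee_fin.
by apply: ereal_sup_ubound; exists n.
Qed.

End Limits.

(** * Choice of constants and of block lengths of small rate *)

Local Open Scope classical_set_scope.

Theorem theorem4 (R : realType) (X : finType) (d : nat)
  (W : X -> 'M[R[i]]_d) (p : X -> R)
  (M : nat -> nat) (cb : forall n : nat, 'I_(M n) -> n.-tuple X) :
  (forall x, density_mx (W x)) ->
  is_distr p ->
  mutual_info W p =
    inf [set mutual_info W q | q in [set q | is_distr q /\ chan_avg W q = chan_avg W p]] ->
  (forall n, (0 < M n)%N) ->
  (limn_einf (fun n : nat => (log2 (M n)%:R / n%:R)%:E) < (mutual_info W p)%:E)%E ->
  limn_esup (fun n : nat =>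
    (trace_norm (code_state W (cb n) - ntensmx (chan_avg W p) n) / 2)%:E) = 1%E.
Proof.
move=> dW dp pinf M0 rate.
set sg := chan_avg W p; have ds : density_mx sg by exact: chan_avg_density.
have hW x : adjmx (W x) = W x by apply: psdmx_adj; case: (dW x).
pose h x := neg_entropy (W x); pose hb := \sum_x p x * h x; pose s := neg_entropy sg.
have ln2 : 0 < ln 2 :> R by rewrite ln_gt0// ltr1n.
have pmin q : is_distr q -> chan_avg W q = sg -> hb <= \sum_x q x * h x.
  move=> dq Wq; suff : mutual_info W p <= mutual_info W q.
    by rewrite !mutual_infoE// Wq ler_pM2r ?invr_gt0// lerD2r.
  rewrite pinf; apply: ge_inf; last by exists q.
  (* [ge_inf] asks for a lower bound of the set; weights in [0, 1] give this one. *)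
  exists ((- \sum_x `|h x| - s) / ln 2) => _ [q' [dq' Wq'] <-].
  rewrite mutual_infoE// Wq' ler_pM2r ?invr_gt0// lerD2r -sumrN.
  apply: ler_sum => x _; have q'1 : q' x <= 1.
    by rewrite -dq'.2 (bigD1 x)//= lerDl sumr_ge0// => y _; exact: dq'.1.
  rewrite lerNl -mulrN; apply: le_trans (ler_norm _) _.
  by rewrite normrM normrN ger0_norm ?dq'.1// ler_piMl.
have IE : mutual_info W p = (hb - s) / ln 2 by exact: mutual_infoE.
have [b bI freq] := limn_einf_lt_frequently rate.
(* The gap is [10 * e]: the test spends [4 * e] and the duality [e], leaving [5 * e] for exponential
   decay. *)
pose e := (hb - s - b * ln 2) / 10.
have e0 : 0 < e by rewrite divr_gt0// subr_gt0 -ltr_pdivlMr// -IE.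
have [L [hL Lh]] := dual_observable hW dp e0 pmin.
rewrite -/hb -/sg in Lh.
pose V := \sum_x (eig_var (W x) + obs_var (W x) L) + eig_var sg + obs_var sg L.
have ev0 (A : 'M[R[i]]_d) : density_mx A -> 0 <= eig_var A.
  move=> dA; apply: sumr_ge0 => k _; rewrite mulr_ge0 ?sqr_ge0//.
  by apply: eigv_ge0; case: dA.
have ov0 (A : 'M[R[i]]_d) : density_mx A -> 0 <= obs_var A L.
  move=> dA; apply: sumr_ge0 => k _; rewrite mulr_ge0 ?sqr_ge0//.
  by apply: diag_in_ge0; case: dA.
have V1 x : eig_var (W x) + obs_var (W x) L <= V.
  have S0 : 0 <= \sum_(y | y != x) (eig_var (W y) + obs_var (W y) L).
    by apply: sumr_ge0 => y _; rewrite addr_ge0 ?ev0 ?ov0.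
  rewrite /V (bigD1 x)//=; have := ev0 _ ds; have := ov0 _ ds; lra.
have V2 : eig_var sg + obs_var sg L <= V.
  by rewrite /V -addrA lerDr sumr_ge0// => y _; rewrite addr_ge0 ?ev0 ?ov0.
apply: limn_esup_eq1 => [n|eps N eps0].
  rewrite ler_pdivrMr// mul1r; apply: trace_norm_le2.
    by apply: density_mixture => // m; exact: chan_word_density.
  by rewrite ntensmx_chan_word; exact: chan_word_density.
(* [K / n] will bound the total error: three Chebyshev terms and exp(- 5 e n), which is at most 1 /
   (5 e n). *)
pose K := 3 * (V / e ^+ 2) + (5 * e)^-1.
have K0 : 0 <= K.
  have V0 : 0 <= V by rewrite (le_trans _ V2)// addr_ge0 ?ev0 ?ov0.
  apply: addr_ge0; first by rewrite mulr_ge0// divr_ge0// sqr_ge0.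
  by rewrite invr_ge0 mulr_ge0// ltW.
(* Past [N] and [K / eps], with rate below [b]; the successor makes [n] positive. *)
have [n Nn vn] := freq (maxn N (Num.bound (K / eps))).+1.
have n0 : (0 < n)%N by apply: leq_trans Nn.
have n0' : (0 : R) < n%:R by rewrite ltr0n.
exists n; first by apply: leq_trans Nn; rewrite ltnW// ltnS leq_maxl.
have Kn : K / n%:R <= eps.
  rewrite ler_pdivrMr// mulrC -ler_pdivrMr//.
  apply: (@le_trans _ _ (Num.bound (K / eps))%:R).
    by apply/ltW/archi_boundP; rewrite divr_ge0// ltW.
  by rewrite ler_nat ltnW// (leq_trans _ Nn)// ltnS leq_maxr.
have Vle x : 0 <= eig_var (W x) by exact: ev0.
have Vle' x : 0 <= obs_var (W x) L by exact: ov0.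
apply: le_trans (block_test (cb n) (V := V) dW ds hL e0 n0 (M0 n) Lh _ _ _ _); last first.
- by apply: le_trans V2; rewrite lerDr ev0.
- by move=> x; apply: le_trans (V1 x); rewrite lerDr.
- by apply: le_trans V2; rewrite lerDl ov0.
- by move=> x; apply: le_trans (V1 x); rewrite lerDl.
have Mb : (M n)%:R * expR (n%:R * (s - (hb - e) + 4 * e)) <= (5 * e)^-1 / n%:R.
  have M0' : (0 : R) < (M n)%:R by rewrite ltr0n.
  have -> : (M n)%:R = expR (ln (M n)%:R) :> R by rewrite lnK.
  have lM : ln (M n)%:R <= n%:R * (b * ln 2).
    move: vn; rewrite /log2 ltr_pdivrMr// ltr_pdivrMr// => /ltW; lra.
  rewrite -expRD; apply: (@le_trans _ _ (expR (- (5 * e * n%:R)))).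
    rewrite ler_expR; move: lM; rewrite (_ : hb = s + b * ln 2 + 10 * e); first lra.
    by rewrite /e; field.
  have en0 : 0 < 5 * e * n%:R by rewrite mulr_gt0// mulr_gt0.
  (* Exponential decay is weakened to order 1 / n through exp x >= 1 + x. *)
  rewrite expRN -invfM lef_pV2 ?posrE ?expR_gt0//.
  by apply: le_trans (expR_ge1Dx _); lra.
have -> : V / (n%:R * e ^+ 2) = V / e ^+ 2 / n%:R by rewrite invfM; ring.
move: Kn; rewrite /K mulrDl; lra.
Qed.
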